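(* Let $C_{(\leq,>)}(x,y)$ be the bivariate generating function of the Catalan words avoiding the ordered pair of relations $(\leq,>)$, where $x$ marks the length and $y$ marks the number of descents. Then $$C_{(\leq,>)}(x,y)=\frac {1-x}{1-2x}.$$
   Context: A Catalan word of length $n$ is a word $w=w_1w_2\cdots w_n$ over the non-negative integers with $w_1=0$ and $0\leq w_i\leq w_{i-1}+1$ for $i=2,\dots,n$; the empty word is the unique Catalan word of length $0$. For relations $X,Y\in\{<,>,\leq,\geq,=,\neq\}$, a word $w$ contains the pattern $(X,Y)$ if there is an index $i\geq 1$ (with $i+2\le n$) such that $w_i\,X\,w_{i+1}$ and $w_{i+1}\,Y\,w_{i+2}$; otherwise $w$ avoids $(X,Y)$. The number of descents $\mathrm{des}(w)$ is the number of indices $i$ with $w_i>w_{i+1}$. The bivariate generating function is $C_{(X,Y)}(x,y)=\sum_{w}x^{|w|}y^{\mathrm{des}(w)}$, the sum being over all Catalan words $w$ (of any length $|w|\geq 0$) avoiding $(X,Y)$. Identities are between formal power series in $x$ with coefficients polynomials in $y$. *)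

(* Defs.v *)
From HB Require Import structures.
From mathcomp Require Import all_boot all_order all_algebra.
From mathcomp Require Import boolp.

Set Implicit Arguments.
Unset Strict Implicit.
Unset Printing Implicit Defensive.

Import GRing.Theory.
Local Open Scope ring_scope.

(** * Formal power series in one variable *)

Record fps (R : Type) := Fps { fps_coef : nat -> R }.

HB.instance Definition _ (R : Type) := gen_eqMixin (fps R).
HB.instance Definition _ (R : Type) := gen_choiceMixin (fps R).

Lemma fps_ext (R : Type) (f g : fps R) :
  (forall n, fps_coef f n = fps_coef g n) -> f = g.
Proof. by case: f g => [f] [g] /= /funext ->. Qed.

Section FpsRing.
Variable R : comNzRingType.
Implicit Types f g h : fps R.

Definition fps0 : fps R := Fps (fun _ => 0).
Definition fps1 : fps R := Fps (fun n => (n == 0)%:R).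
Definition fps_opp f : fps R := Fps (fun n => - fps_coef f n).
Definition fps_add f g : fps R := Fps (fun n => fps_coef f n + fps_coef g n).
Definition fps_mul f g : fps R :=
  Fps (fun n => \sum_(i < n.+1) fps_coef f i * fps_coef g (n - i)%N).

Lemma fps_addA : associative fps_add.
Proof. by move=> f g h; apply: fps_ext => n /=; rewrite addrA. Qed.
Lemma fps_addC : commutative fps_add.
Proof. by move=> f g; apply: fps_ext => n /=; rewrite addrC. Qed.
Lemma fps_add0 : left_id fps0 fps_add.
Proof. by move=> f; apply: fps_ext => n /=; rewrite add0r. Qed.
Lemma fps_addN : left_inverse fps0 fps_opp fps_add.
Proof. by move=> f; apply: fps_ext => n /=; rewrite addNr. Qed.

HB.instance Definition _ :=
  GRing.isZmodule.Build (fps R) fps_addA fps_addC fps_add0 fps_addN.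

Definition fps_trunc (n : nat) f : {poly R} := \poly_(i < n.+1) fps_coef f i.

Lemma coef_fps_trunc n f k :
  (k <= n)%N -> (fps_trunc n f)`_k = fps_coef f k.
Proof. by move=> kn; rewrite coef_poly ltnS kn. Qed.

Lemma coef_fps_truncM n f g k : (k <= n)%N ->
  (fps_trunc n f * fps_trunc n g)`_k = fps_coef (fps_mul f g) k.
Proof.
move=> kn; rewrite coefM; apply: eq_bigr => i _.
rewrite !coef_fps_trunc //; first exact: leq_trans (leq_subr _ _) kn.
by apply: leq_trans kn; rewrite -ltnS.
Qed.

Lemma fps_mulC : commutative fps_mul.
Proof.
by move=> f g; apply: fps_ext => n; rewrite -!(coef_fps_truncM _ _ (leqnn n)) mulrC.
Qed.

Lemma fps_mulA : associative fps_mul.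
Proof.
move=> f g h; apply: fps_ext => n.
transitivity (fps_trunc n f * (fps_trunc n g * fps_trunc n h))`_n.
  rewrite coefM; apply: eq_bigr => i _.
  by rewrite coef_fps_truncM ?leq_subr // coef_fps_trunc // -ltnS.
rewrite mulrA coefM; apply: eq_bigr => i _.
by rewrite coef_fps_truncM ?coef_fps_trunc ?leq_subr // -ltnS.
Qed.

Lemma fps_mul1 : left_id fps1 fps_mul.
Proof.
move=> f; apply: fps_ext => n /=.
by rewrite big_ord_recl /= mul1r subn0 big1 ?addr0 // => i _; rewrite mul0r.
Qed.

Lemma fps_mulD : left_distributive fps_mul fps_add.
Proof.
move=> f g h; apply: fps_ext => n /=; rewrite -big_split /=.
by apply: eq_bigr => i _; rewrite mulrDl.
Qed.

Lemma fps1_neq0 : fps1 != 0.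
Proof. by apply/eqP=> /(congr1 (fun f => fps_coef f 0))/eqP; rewrite /= oner_eq0. Qed.

HB.instance Definition _ := GRing.Zmodule_isComNzRing.Build (fps R)
  fps_mulA fps_mulC fps_mul1 fps_mulD fps1_neq0.

Definition fpsX : fps R := Fps (fun n => (n == 1)%:R).

Lemma coef_fps1 n : fps_coef (1 : fps R) n = (n == 0)%:R.
Proof. by []. Qed.
Lemma coef_fpsX n : fps_coef fpsX n = (n == 1)%:R.
Proof. by []. Qed.
Lemma coef_fpsD f g n : fps_coef (f + g) n = fps_coef f n + fps_coef g n.
Proof. by []. Qed.
Lemma coef_fpsN f n : fps_coef (- f) n = - fps_coef f n.
Proof. by []. Qed.
Lemma coef_fpsM f g n : fps_coef (f * g) n =
  \sum_(i < n.+1) fps_coef f i * fps_coef g (n - i)%N.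
Proof. by []. Qed.
End FpsRing.

Section FpsUnit.
Variable R : comUnitRingType.
Implicit Types f g : fps R.

Definition fps_unit : {pred fps R} :=
  fun f => fps_coef f 0 \is a GRing.unit.

(* [fps_invs f n] lists the first [n] coefficients of the inverse [g] of [f],
   obtained by solving [f 0 * g k + \sum_(i < k) f (k - i) * g i = (k == 0)]
   for [g k]. *)
Fixpoint fps_invs f (n : nat) : seq R :=
  if n is k.+1 then
    let s := fps_invs f k in
    rcons s ((fps_coef f 0)^-1 *
      ((k == 0)%:R - \sum_(i < k) fps_coef f (k - i)%N * s`_i))
  else [::].

Definition fps_inv f : fps R :=
  if fps_unit f then Fps (fun n => (fps_invs f n.+1)`_n) else f.

Lemma size_fps_invs f n : size (fps_invs f n) = n.
Proof. by elim: n => //= n IH; rewrite size_rcons IH. Qed.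

Lemma nth_fps_invs f n k :
  (k < n)%N -> (fps_invs f n)`_k = (fps_invs f k.+1)`_k.
Proof.
elim: n => // n IH; rewrite ltnS leq_eqVlt => /predU1P[-> //|kn].
by rewrite [LHS]nth_rcons size_fps_invs kn IH.
Qed.

Lemma fps_mulV : {in fps_unit, left_inverse 1 fps_inv *%R}.
Proof.
move=> f fU; rewrite /fps_inv ifT //; apply: fps_ext => n.
rewrite coef_fpsM big_ord_recr /= subnn nth_rcons size_fps_invs ltnn eqxx.
rewrite mulrC mulrA divrr // mul1r addrC -[RHS](subrK (\sum_(i < n)
  fps_coef f (n - i)%N * (fps_invs f n)`_i)); congr (_ + _).
apply: eq_bigr => i _; rewrite mulrC; congr (_ * _).
by rewrite [RHS]nth_fps_invs.
Qed.

Lemma fps_unitPl f g : g * f = 1 -> fps_unit f.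
Proof.
move=> /(congr1 (fun h => fps_coef h 0)); rewrite coef_fpsM big_ord1 /= => h.
by apply/unitrPr; exists (fps_coef g 0); rewrite mulrC.
Qed.

Lemma fps_inv_out : {in [predC fps_unit], fps_inv =1 id}.
Proof. by move=> f fU; rewrite /fps_inv ifN. Qed.

HB.instance Definition _ := GRing.ComNzRing_hasMulInverse.Build (fps R)
  fps_mulV fps_unitPl fps_inv_out.

Lemma fps_unitE f : (f \is a GRing.unit) = (fps_coef f 0 \is a GRing.unit).
Proof. by []. Qed.
End FpsUnit.

Arguments fpsX {R}.

Lemma fps_unit_1subZX (R : comUnitRingType) (a : fps R) :
  1 - a * fpsX \is a GRing.unit.
Proof.
by rewrite fps_unitE coef_fpsD coef_fpsN coef_fpsM big_ord1 coef_fps1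
  coef_fpsX mulr0 subr0 unitr1.
Qed.

(** * Catalan words (letters are indexed from 0) *)

Definition catalan_word (w : seq nat) : bool :=
  (nth 0%N w 0 == 0%N) &&
  [forall i : 'I_(size w).-1, (nth 0 w i.+1 <= (nth 0 w i).+1)%N].

Definition contains_pattern (X Y : rel nat) (w : seq nat) : bool :=
  [exists i : 'I_(size w - 2),
     X (nth 0%N w i) (nth 0%N w i.+1) && Y (nth 0%N w i.+1) (nth 0%N w i.+2)].

Definition avoids_pattern (X Y : rel nat) (w : seq nat) : bool :=
  ~~ contains_pattern X Y w.

Definition des (w : seq nat) : nat :=
  #|[set i : 'I_(size w).-1 | (nth 0 w i > nth 0 w i.+1)%N]|.

(* The letters of a Catalan word of length [n] are smaller than [n], so that
   [catalan_gf] below loses no word by ranging over [n.-tuple 'I_n]. *)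
Lemma catalan_word_lt (w : seq nat) :
  catalan_word w -> all (fun a => a < size w)%N w.
Proof.
case/andP=> /eqP w0 /forallP wS; apply/(all_nthP 0%N) => i.
suff H : forall k, (k < size w)%N -> (nth 0 w k <= k)%N.
  by move=> iw; apply: leq_ltn_trans (H _ iw) iw.
elim=> [|k IH] kw; first by rewrite w0.
have kw' : (k < (size w).-1)%N by case: (size w) kw.
by apply: leq_trans (wS (Ordinal kw')) _; rewrite ltnS IH // ltnW.
Qed.

(* The variable [x] is [fpsX] and [y] is ['X : {poly int}]. *)
Definition catalan_gf (X Y : rel nat) : fps {poly int} :=
  Fps (fun n =>
    \sum_(w : n.-tuple 'I_n | let v := map val w in
            catalan_word v && avoids_pattern X Y v) 'X^(des (map val w))).

(* Main.v *)
(** The first letter of a Catalan word is its smallest letter, so a word of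
    length at least 2 starts with a weak ascent.  Avoiding [(<=, >)] then
    propagates the weak ascent to every later position: the word has no
    descent, and each letter either repeats the previous one or exceeds it by
    one.  There are [2 ^ n] such words of length [n + 1]. *)

Require Import Defs.
From HB Require Import structures.
From mathcomp Require Import all_boot all_order all_algebra.

Set Implicit Arguments.
Unset Strict Implicit.
Unset Printing Implicit Defensive.

Import GRing.Theory.
Local Open Scope ring_scope.

Definition flat_or_up : rel nat := fun a b => (a <= b <= a.+1)%N.

Lemma catalan_wordP (w : seq nat) :
  reflect (nth 0 w 0 = 0 /\
           forall i, i.+1 < size w -> nth 0 w i.+1 <= (nth 0 w i).+1)%N
          (catalan_word w).
Proof.
apply: (iffP andP) => [[/eqP w0 /forallP wS]|[-> wS]].
  split=> // i iw; have iw' : (i < (size w).-1)%N by case: (size w) iw.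
  exact: wS (Ordinal iw').
by split=> //; apply/forallP => -[i /= iw]; apply: wS; case: (size w) iw.
Qed.

Lemma avoids_patternP (X Y : rel nat) (w : seq nat) :
  reflect (forall i, (i.+2 < size w)%N -> X (nth 0%N w i) (nth 0%N w i.+1) ->
             ~~ Y (nth 0%N w i.+1) (nth 0%N w i.+2))
          (avoids_pattern X Y w).
Proof.
apply: (iffP existsPn) => [wXY i iw Xi|wXY [i /= iw]].
  have iw' : (i < size w - 2)%N by rewrite ltn_subRL.
  by have := wXY (Ordinal iw'); rewrite /= Xi.
by rewrite negb_and -implybE; apply/implyP/wXY; rewrite ltn_subRL in iw.
Qed.

(** The Catalan condition supplies the upper bound in [flat_or_up]; avoidance supplies the lower
    bound, by induction on the position. *)
Lemma catalan_avoids_le_gtE (a : nat) (u : seq nat) :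
  catalan_word (a :: u) && avoids_pattern leq gtn (a :: u) =
  (a == 0)%N && path flat_or_up a u.
Proof.
apply/andP/andP => [[/catalan_wordP[/= a0 wS] /avoids_patternP wA]|[/eqP a0]].
  split; first exact/eqP.
  apply/(pathP 0%N) => i iu; rewrite /flat_or_up (wS i iu) andbT.
  elim: i iu => [|i IH] iu; first by rewrite /= a0.
  by have := wA i iu (IH (ltnW iu)); rewrite -leqNgt.
move=> /(pathP 0%N) uP.
have {}uP i : (i < size u)%N ->
    (nth 0 (a :: u) i <= nth 0 (a :: u) i.+1 <= (nth 0 (a :: u) i).+1)%N.
  exact: uP.
split; first by apply/catalan_wordP; split=> // i iu; case/andP: (uP i iu).
apply/avoids_patternP => i iu _; rewrite -leqNgt.
by case/andP: (uP i.+1 iu).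
Qed.

Lemma des_path_flat_or_up (a : nat) (u : seq nat) :
  path flat_or_up a u -> des (a :: u) = 0%N.
Proof.
move=> /(pathP 0%N) uP; apply: eq_card0 => -[i /= iu]; rewrite inE /=.
by have /andP[+ _] := uP i iu; rewrite leqNgt => /negbTE.
Qed.

(** Splits off the first letter, for recursion on the length. [P] and [F] act on sequences, so they
    apply to [x :: u] as is. *)
Lemma big_tuple_cons (R : Type) (idx : R) (op : Monoid.com_law idx)
    (T : finType) (n : nat) (P : pred (seq T)) (F : seq T -> R) :
  \big[op/idx]_(w : n.+1.-tuple T | P w) F w =
  \big[op/idx]_(x : T) \big[op/idx]_(u : n.-tuple T | P (x :: u)) F (x :: u).
Proof.
rewrite pair_big_dep /=.
rewrite (reindex (fun p : T * n.-tuple T => [tuple of p.1 :: p.2])) //=.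
exists (fun w => (thead w, [tuple of behead w])) => [[x u] _|w _].
  by congr pair; apply: val_inj.
by rewrite [w in RHS]tuple_eta; apply: val_inj.
Qed.

(** Each step has two choices, so the count doubles. The start [a] varies because the induction
    moves to [a] or [a.+1]; the bound keeps every reachable letter, at most [a + n], inside
    ['I_m]. *)
Lemma sum_path_flat_or_up (R : pzSemiRingType) (m n a : nat) : (a + n < m)%N ->
  \sum_(u : n.-tuple 'I_m | path flat_or_up a (map val u)) 1 = 2%:R ^+ n :> R.
Proof.
elim: n a => [|n IH] a anm.
  by rewrite (big_pred1 [tuple]) // => u; rewrite tuple0; apply/esym/eqP.
rewrite (big_tuple_cons _ _ (fun u => path flat_or_up a (map val u))
  (fun=> 1)) /=.
have a1m : (a.+1 < m)%N by apply: leq_trans anm; rewrite addnS !ltnS leq_addr.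
have am := ltnW a1m.
rewrite (bigD1 (Ordinal am)) // (bigD1 (Ordinal a1m)) /=; last first.
  by rewrite -val_eqE /= gtn_eqF.
(* A first letter [x] other than [a] and [a.+1] starts no path: the two bounds would become [a < x]
   and [x <= a]. *)
rewrite [X in _ + (_ + X)]big1 => [|x /andP[xa xa1]]; last first.
  apply: big_pred0 => u; rewrite -!val_eqE /= in xa xa1 *.
  rewrite /flat_or_up [(a <= _)%N]leq_eqVlt eq_sym (negbTE xa).
  by rewrite [(x <= _)%N]leq_eqVlt (negbTE xa1) ltnS [(x <= a)%N]leqNgt andbN.
rewrite /flat_or_up !leqnn !leqnSn !IH ?addr0 ?addSnnS //.
  by rewrite exprS mulr_natl mulr2n.
by apply: leq_trans anm; rewrite addnS.
Qed.

Lemma coef_catalan_gf_le_gt n :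
  fps_coef (catalan_gf leq gtn) n = if n is k.+1 then 2%:R ^+ k else 1.
Proof.
case: n => [|n] /=.
  rewrite (big_pred1 [tuple]) => [|u]; first by rewrite /des /= eq_card0 // => -[].
  rewrite tuple0; transitivity true; last exact/esym/eqP.
  apply/andP; split.
    exact/catalan_wordP.
  exact/avoids_patternP.
rewrite (big_tuple_cons _ _ (fun w => let v := map val w in
  catalan_word v && avoids_pattern leq gtn v) (fun w => 'X^(des (map val w)))) /=.
(* Only the first letter 0 contributes. *)
rewrite big_ord_recl [X in _ + X]big1 => [|i _]; last first.
  by apply: big_pred0 => u; rewrite catalan_avoids_le_gtE.
(* The alphabet ['I_n.+1] is just large enough: [0 + n < n.+1]. *)
rewrite addr0 -(@sum_path_flat_or_up _ n.+1 n 0) //.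
apply: eq_big => u; rewrite catalan_avoids_le_gtE //=.
by move=> uP; rewrite des_path_flat_or_up.
Qed.

Lemma coef_fpsMX (R : comNzRingType) (f : fps R) n :
  fps_coef (f * fpsX) n = if n is k.+1 then fps_coef f k else 0.
Proof.
case: n => [|n]; first by rewrite coef_fpsM big_ord1 coef_fpsX mulr0.
rewrite mulrC coef_fpsM !big_ord_recl big1 => [|i _] /=.
  by rewrite mul0r mul1r add0r addr0 subn1.
by rewrite mul0r.
Qed.

Theorem theorem3p25 :
  catalan_gf leq gtn = (1 - fpsX) / (1 - 2%:R * fpsX).
Proof.
apply: (canRL (mulrK (fps_unit_1subZX 2%:R))).
apply: fps_ext => n.
(* With the denominator cleared, the product becomes [C - (C * fpsX + C * fpsX)], so only index
   shifts remain. *)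
rewrite mulrBr mulr1 mulrCA mulr_natl mulr2n.
rewrite !(coef_fpsD, coef_fpsN, coef_fpsMX, coef_catalan_gf_le_gt).
rewrite coef_fps1 coef_fpsX.
(* The coefficients are 1 in degree 0, [1 - 2 = -1] in degree 1, and [2 ^ n.+1 - 2 * 2 ^ n = 0] in
   degree [n.+2]. *)
case: n => [|[|n]]; rewrite ?coef_catalan_gf_le_gt ?addr0 //=.
  by rewrite expr0 opprD addrA subrr.
by rewrite exprS mulr_natl mulr2n !subrr.
Qed.
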